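(* Let $k \in \mathbb{N}$ and let $\alpha \in \mathbb{R} \setminus \mathbb{Q}$ have continued fraction expansion $[a_0;a_1;a_2;\ldots]$ with $\limsup_{i \to \infty} a_i \leq k-1$. Then the rotation $f_\alpha: x \mapsto x+\alpha \bmod 1$ of the unit torus satisfies $$F_k(f_\alpha) > F_1(f_\alpha).$$
   Context: Let $\mathbb{T}_1 = [0,1)$ be the unit torus (endpoints glued), equipped with the Lebesgue probability measure $\mu$. For irrational $\alpha$, $f_\alpha:\mathbb{T}_1\to\mathbb{T}_1$ is $f_\alpha(x) = x+\alpha \bmod 1$. An interval is an arc of the torus that is closed on the left and open on the right, of positive length. For $n \in \mathbb{N}$ (positive integers) and a transformation $T$ of $\mathbb{T}_1$ preserving $\mu$, the covering number by $n$ intervals $F_n(T)$ is the supremum of all $z \in \mathbb{R}$ such that for every $h_0 \in \mathbb{N}$ there exist an integer $h \geq h_0$ and a set $B$ that is a union of $n$ pairwise disjoint intervals such that (1) $B, TB, \ldots, T^{h-1}B$ are pairwise disjoint, and (2) $\mu\left(\bigcup_{k=0}^{h-1} T^k B\right) \geq z$. The $n$ disjoint intervals making up $B$ are allowed to be adjacent (the right endpoint of one may equal the left endpoint of the next): up to rotation, $B = \bigcup_{i=1}^{n} [c_i, c_i+\beta_i)$ with $c_1 = 0$, $\beta_i>0$ and $c_i \geq c_{i-1}+\beta_{i-1}$ for $2 \le i \le n$. *)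

(* Defs.v *)
From HB Require Import structures.
From mathcomp Require Import all_boot all_order all_algebra.
From mathcomp Require Import all_classical all_reals all_analysis.
Import Order.TTheory GRing.Theory Num.Theory.
Import numFieldNormedType.Exports.

Set Implicit Arguments.
Unset Strict Implicit.
Unset Printing Implicit Defensive.

Local Open Scope classical_set_scope.
Local Open Scope ring_scope.

(* The unit torus is the set [0, 1[ of real numbers, each class of R / Z being
   represented by its fractional part. A transformation of the torus is a
   function T : R -> R, of which only the restriction to [0, 1[ matters. *)
Definition torus (R : realType) : set R := `[0, 1[.

Definition torus_measure (R : realType) (A : set R) : \bar R :=
  lebesgue_measure (A `&` @torus R).

Definition frac_part (R : realType) (x : R) : R := x - (Num.floor x)%:~R.

Definition rotation (R : realType) (alpha x : R) : R := frac_part (x + alpha).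

(* An arc may wrap around 0. The bound b <= 1 makes b the length of the arc. *)
Definition is_arc (R : realType) (I : set R) : Prop :=
  exists c b : R, [/\ 0 < b, b <= 1 & I = @frac_part R @` `[c, c + b[].

(* The arcs are disjoint as half-open sets, so they may be adjacent. *)
Definition is_union_of_arcs (R : realType) (n : nat) (B : set R) : Prop :=
  exists I : 'I_n -> set R,
    [/\ forall i, is_arc (I i), trivIset setT I & B = \bigcup_i I i].

(* The supremum is taken in the extended reals: no default value is involved
   when no real number z qualifies. *)
Definition covering_number (R : realType) (n : nat) (T : R -> R) : \bar R :=
  ereal_sup [set z%:E | z in [set z : R |
    forall h0 : nat, (0 < h0)%N ->
      exists (h : nat) (B : set R),
        [/\ (h0 <= h)%N,
            is_union_of_arcs n B,
            trivIset `I_h (fun j => iter j T @` B) &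
            (z%:E <= torus_measure (\bigcup_(j in `I_h) (iter j T @` B)))%E]]].

(* Regular continued fraction expansion x = [a_0; a_1; ...]: the complete
   quotients are x_0 = x and x_{i+1} = 1 / (x_i - floor x_i), and a_i = floor x_i.
   For irrational x no division by zero occurs. *)
Definition complete_quotient (R : realType) (x : R) (i : nat) : R :=
  iter i (fun y => (frac_part y)^-1) x.

Definition partial_quotient (R : realType) (x : R) (i : nat) : int :=
  Num.floor (complete_quotient x i).

(* Main.v *)
(* Write q_n for the denominators of the convergents of alpha and
   d_n = |q_n alpha - p_n|, so that q_n d_(n-1) + q_(n-1) d_n = 1.

   If the h first iterates of one arc of length b are disjoint and
   q_(n-1) < h <= q_n, then b <= d_(n-1), whence a covered measure of at most
   q_n d_(n-1).

   Let a = a_(n+1) <= k - 1.  With h about (q_(n+1) + q_n) / (a + 1), consider a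
   arcs of length d_n, based at 0, h alpha, ..., (a - 1) h alpha, and one of length
   d_(n+1), based at a h alpha.  Their first h iterates are disjoint: a collision
   would put some e alpha with 0 < e < q_(n+1) + q_n strictly between the
   neighbours q_(n+1) alpha and q_n alpha of 0 in the torus.  They cover
   h (a d_n + d_(n+1)) = h d_(n-1), and h is about q_n + q_(n-1) / (a + 1), so this
   exceeds q_n d_(n-1) >= 1/2 by a fixed proportion, the a_i being bounded. *)

Require Import Defs.
From mathcomp Require Import all_boot all_order all_algebra.
From mathcomp Require Import all_classical all_reals all_analysis.
From mathcomp Require Import zify ring lra.
Import Order.TTheory GRing.Theory Num.Theory.
Import numFieldNormedType.Exports.

Set Implicit Arguments.
Unset Strict Implicit.
Unset Printing Implicit Defensive.

Local Open Scope classical_set_scope.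
Local Open Scope ring_scope.

(** * Arcs of the torus: rotation, measure, disjointness *)

Definition torus_arc (R : realType) (c b : R) : set R := @frac_part R @` `[c, c + b[.

Lemma frac_part_itv (R : realType) (x : R) : 0 <= frac_part x < 1.
Proof.
have /andP[h1 h2] := floor_itv x; rewrite /frac_part.
by move: h2; rewrite intrD => h2; apply/andP; split; lra.
Qed.

Lemma frac_part_def (R : realType) (x y : R) (p : int) :
  0 <= y < 1 -> x = y + p%:~R -> frac_part x = y.
Proof.
move=> /andP[y0 y1] ->; rewrite /frac_part (@floor_def _ _ p); first by ring.
by rewrite intrD; apply/andP; split; lra.
Qed.

Lemma frac_partDz (R : realType) (x : R) (p : int) :
  frac_part (x + p%:~R) = frac_part x.
Proof.
apply: (@frac_part_def _ _ _ (p + Num.floor x)); first exact: frac_part_itv.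
by rewrite /frac_part intrD; ring.
Qed.

(** Lifting to the real line turns questions about arcs into linear inequalities up to an integer
    translation. *)
Lemma arcP (R : realType) (c b x : R) :
  torus_arc c b x <-> 0 <= x < 1 /\ exists p : int, c <= x + p%:~R < c + b.
Proof.
split=> [[y] /=|[x01 [p hp]]].
  rewrite in_itv /= => hy <-; split; first exact: frac_part_itv.
  by exists (Num.floor y); rewrite /frac_part subrK.
by exists (x + p%:~R); rewrite /= ?in_itv //=; apply: (frac_part_def x01).
Qed.

Lemma arcDz (R : realType) (c b : R) (p : int) : torus_arc (c + p%:~R) b = torus_arc c b.
Proof.
apply/seteqP; split=> x /arcP[x01 [q hq]]; apply/arcP; split=> //.
  by exists (q - p); rewrite intrB; lra.
by exists (q + p); rewrite intrD; lra.
Qed.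

Lemma iter_rotation_frac_part (R : realType) (alpha x : R) (j : nat) :
  iter j (rotation alpha) (frac_part x) = frac_part (x + j%:R * alpha).
Proof.
elim: j => [|j IH]; first by rewrite mul0r addr0.
rewrite iterS IH /rotation [in LHS]/frac_part.
rewrite -[RHS](@frac_partDz _ _ (- Num.floor (x + j%:R * alpha))).
by congr (_ - _%:~R); rewrite /frac_part mulrS intrN; first ring; congr Num.floor; ring.
Qed.

Lemma iter_rotation_arc (R : realType) (alpha c b : R) (j : nat) :
  iter j (rotation alpha) @` torus_arc c b = torus_arc (c + j%:R * alpha) b.
Proof.
apply/seteqP; split=> [_ [_ [y hy <-] <-]|_ [y hy <-]].
  exists (y + j%:R * alpha); last by rewrite iter_rotation_frac_part.
  by move: hy; rewrite /= !in_itv /=; lra.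
exists (frac_part (y - j%:R * alpha)).
  exists (y - j%:R * alpha) => //.
  by move: hy; rewrite /= !in_itv /=; lra.
by rewrite iter_rotation_frac_part subrK.
Qed.

Lemma arc_sub_torus (R : realType) (c b : R) : torus_arc c b `<=` @torus R.
Proof. by move=> x /arcP[x01 _]; rewrite /torus /= in_itv. Qed.

Lemma arc_frac_part (R : realType) (c b : R) : torus_arc (frac_part c) b = torus_arc c b.
Proof. by rewrite /frac_part -intrN arcDz. Qed.

Lemma arc_nowrap (R : realType) (c b : R) :
  0 <= c -> c + b <= 1 -> torus_arc c b = `[c, c + b[%classic.
Proof.
move=> c0 cb; apply/seteqP; split=> x /=; rewrite in_itv /=.
  move=> /arcP[/andP[x0 x1] [p /andP[h1 h2]]].
  suff -> : x = x + p%:~R by rewrite h1 h2.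
  have : - 1 < p%:~R :> R by lra.
  have : p%:~R < 1 :> R by lra.
  rewrite -[1]/(1%:~R) -intrN !ltr_int => p1 p2.
  by rewrite (_ : p = 0) ?addr0//; lia.
move=> /andP[h1 h2]; apply/arcP; split; first by apply/andP; split; lra.
by exists 0; rewrite addr0 h1.
Qed.

Lemma arc_wrap (R : realType) (c b : R) :
  0 <= c < 1 -> b <= 1 -> 1 < c + b ->
  torus_arc c b = (`[c, 1[ `|` `[0, c + b - 1[)%classic.
Proof.
move=> /andP[c0 c1] b1 cb; apply/seteqP; split=> x /=; rewrite !in_itv /=.
  move=> /arcP[/andP[x0 x1] [p /andP[h1 h2]]].
  have : - 1 < p%:~R :> R by lra.
  have : p%:~R < 2 :> R by lra.
  rewrite -[1]/(1%:~R) -[2]/(2%:~R) -intrN !ltr_int => p1 p2.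
  have [p0|p0] : p = 0 \/ p = 1 by lia.
    by left; move: h1; rewrite p0 addr0 => ->.
  right; rewrite x0 /=; move: h2; rewrite p0; lra.
move=> [/andP[h1 h2]|/andP[h1 h2]]; apply/arcP; split.
- by apply/andP; split; lra.
- by exists 0; rewrite addr0 h1; lra.
- by apply/andP; split; lra.
- by exists 1; apply/andP; split; lra.
Qed.

Lemma measurable_arc (R : realType) (c b : R) : b <= 1 -> measurable (torus_arc c b).
Proof.
move=> b1; rewrite -arc_frac_part; have c01 := frac_part_itv c.
have [cb|cb] := lerP (frac_part c + b) 1; last first.
  by rewrite arc_wrap //; apply: measurableU; exact: measurable_itv.
by rewrite arc_nowrap //; case/andP: c01.
Qed.

Lemma lebesgue_measure_arc (R : realType) (c b : R) :
  0 <= b <= 1 -> lebesgue_measure (torus_arc c b) = b%:E.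
Proof.
move=> /andP[b0 b1]; rewrite -arc_frac_part.
have c01 := frac_part_itv c; move: (frac_part c) c01 => {}c c01.
have itvE (x y : R) : x <= y -> lebesgue_measure `[x, y[%classic = (y - x)%:E.
  rewrite lebesgue_measure_itv /= lte_fin le_eqVlt => /orP[/eqP ->|->].
    by rewrite ltxx subrr.
  by rewrite EFinB.
have [cb|cb] := lerP (c + b) 1.
  rewrite arc_nowrap ?itvE //; first by congr EFin; ring.
    by lra.
  by case/andP: c01.
rewrite arc_wrap // measureU.
- transitivity ((1 - c)%:E + (c + b - 1 - 0)%:E)%E.
    by congr adde; apply: itvE; lra.
  by rewrite -EFinD; congr EFin; ring.
- exact: measurable_itv.
- exact: measurable_itv.
- apply/seteqP; split=> // x [] /=; rewrite !in_itv /=; lra.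
Qed.

(** Two lifts of a common point differ by an integer, which would be a forbidden [p]. *)
Lemma arc_disjoint (R : realType) (c b c' b' : R) :
  (forall p : int, ~ (- b' < c' - c - p%:~R < b)) -> torus_arc c b `&` torus_arc c' b' = set0.
Proof.
move=> h; apply/seteqP; split=> // x [/arcP[_ [p hp]] /arcP[_ [q hq]]].
by apply: (h (q - p)); rewrite intrB; lra.
Qed.

(** The sign of [t - p] tells which of the two left endpoints lies in the other arc. *)
Lemma arc_meet (R : realType) (c b t : R) (p : int) :
  `|t - p%:~R| < b -> torus_arc c b `&` torus_arc (c + t) b !=set0.
Proof.
rewrite ltr_norml => tb; have [t0|t0] := leP 0 (t - p%:~R).
  exists (frac_part (c + t)); split.
    rewrite -(arcDz _ _ p); exists (c + t) => //=.
    by rewrite in_itv /=; lra.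
  by exists (c + t) => //=; rewrite in_itv /=; lra.
exists (frac_part c); split.
  by exists c => //=; rewrite in_itv /=; lra.
rewrite -(arcDz _ _ (- p)); exists c => //=.
by rewrite in_itv /= intrN; lra.
Qed.

Lemma arc_halve (R : realType) (c b : R) : 0 < b ->
  torus_arc c b = torus_arc c (b / 2) `|` torus_arc (c + b / 2) (b / 2).
Proof.
move=> b0; rewrite /torus_arc -image_setU; congr image; apply/seteqP; split=> x /=;
  rewrite !in_itv /=; last by lra.
by have [h|h] := ltP x (c + b / 2); [left|right]; lra.
Qed.

Lemma arc_halve_disjoint (R : realType) (c b : R) : 0 < b -> b <= 1 ->
  torus_arc c (b / 2) `&` torus_arc (c + b / 2) (b / 2) = set0.
Proof.
move=> b0 b1; apply: arc_disjoint => p /andP[h1 h2].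
have : 0 < p%:~R :> R by lra.
have : p%:~R < 1 :> R by lra.
by rewrite -[0 in X in _ -> X -> _]/(0%:~R) -[1]/(1%:~R) !ltr_int; lia.
Qed.

(** * Continued fractions: convergents, their errors, best approximation *)

Lemma irrational_frac_part_inv (R : realType) (x : R) :
  irrational x -> irrational (frac_part x)^-1.
Proof.
apply: contra_not => -[q _ qE]; exists (q^-1 + (Num.floor x)%:~R) => //.
by rewrite rmorphD fmorphV /= qE invrK ratr_int /frac_part subrK.
Qed.

Lemma irrational_frac_part_gt0 (R : realType) (x : R) :
  irrational x -> 0 < frac_part x.
Proof.
move=> xirr; have /andP[x0 _] := frac_part_itv x; rewrite lt_neqAle x0 andbT.
apply: contra_notN xirr => /eqP fx0; exists (Num.floor x)%:~R => //.
by rewrite ratr_int -[LHS]add0r fx0 /frac_part subrK.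
Qed.

Section ContinuedFraction.
Context {R : realType} (alpha : R) (alpha_irr : irrational alpha).

(* The indices are shifted by one: in the usual notation these are q_(n-1),
   p_(n-1) and |q_(n-1) alpha - p_(n-1)|. *)
Fixpoint cf_den (n : nat) : nat :=
  match n with
  | 0 => 0
  | n1.+1 => match n1 with
             | 0 => 1
             | n2.+1 => `|partial_quotient alpha n1| * cf_den n1 + cf_den n2
             end
  end.

Fixpoint cf_num (n : nat) : int :=
  match n with
  | 0 => 1
  | n1.+1 => match n1 with
             | 0 => partial_quotient alpha 0
             | n2.+1 => partial_quotient alpha n1 * cf_num n1 + cf_num n2
             end
  end.

(** The product form makes positivity and decrease immediate; [den_num_err] identifies it, up to
    sign, with the error of the convergent. *)
Definition cf_err (n : nat) : R := \prod_(i < n) frac_part (complete_quotient alpha i).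

Lemma complete_quotient_irrational n : irrational (complete_quotient alpha n).
Proof. by elim: n => // n IH; exact: irrational_frac_part_inv. Qed.

Lemma cf_err_gt0 n : 0 < cf_err n.
Proof.
apply: prodr_gt0 => i _; apply: irrational_frac_part_gt0.
exact: complete_quotient_irrational.
Qed.

Lemma cf_err_lt n : cf_err n.+1 < cf_err n.
Proof.
rewrite /cf_err big_ord_recr /= -[X in _ < X]mulr1 ltr_pM2l; last exact: cf_err_gt0.
by case/andP: (frac_part_itv (complete_quotient alpha n)).
Qed.

Lemma cf_err_le1 n : cf_err n <= 1.
Proof.
elim: n => [|n IH]; first by rewrite /cf_err big_ord0.
exact: le_trans (ltW (cf_err_lt n)) IH.
Qed.

Lemma partial_quotient_ge1 n : 1 <= partial_quotient alpha n.+1.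
Proof.
rewrite /partial_quotient floor_ge_int /= invf_ge1.
  by case/andP: (frac_part_itv (complete_quotient alpha n)) => _ /ltW.
exact/irrational_frac_part_gt0/complete_quotient_irrational.
Qed.

(** With [y] the fractional part of the [n]-th complete quotient, this is [cf_err n] times
    [1 = y * y^-1], where [y^-1] is split into its integer and fractional parts. *)
Lemma cf_err_rec n : cf_err n = `|partial_quotient alpha n.+1|%:R * cf_err n.+1 + cf_err n.+2.
Proof.
have xn0 := irrational_frac_part_gt0 (@complete_quotient_irrational n).
rewrite natr_absz ger0_norm; last by have := partial_quotient_ge1 n; lia.
rewrite /cf_err !big_ord_recr /= -/(cf_err n); set y := frac_part _ in xn0 *.
have -> : frac_part y^-1 = y^-1 - (partial_quotient alpha n.+1)%:~R by [].
have yK : y * y^-1 = 1 by rewrite divff // gt_eqF.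
transitivity (cf_err n * (y * y^-1)); first by rewrite yK mulr1.
ring.
Qed.

Lemma absz_partial_quotient n :
  (`|partial_quotient alpha n.+1|%N : int) = partial_quotient alpha n.+1.
Proof. by rewrite abszE ger0_norm //; have := partial_quotient_ge1 n; lia. Qed.

Lemma cf_den_rec n : cf_den n.+2 = (`|partial_quotient alpha n.+1| * cf_den n.+1 + cf_den n)%N.
Proof. by []. Qed.

Lemma cf_den_gt0 n : (0 < cf_den n.+1)%N.
Proof.
elim: n => // n IH; rewrite cf_den_rec; have := partial_quotient_ge1 n.
by move: (partial_quotient _ _) => a a1; nia.
Qed.

Lemma leq_cf_den_add n : (cf_den n.+1 + cf_den n <= cf_den n.+2)%N.
Proof.
rewrite cf_den_rec; have := partial_quotient_ge1 n.
by move: (partial_quotient _ _) => a a1; nia.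
Qed.

Lemma cf_den_ge n : (n <= cf_den n.+1)%N /\ (n.+1 <= cf_den n.+2)%N.
Proof.
elim: n => [|n [h1 h2]]; first by split=> //; exact: cf_den_gt0.
by split=> //; have := leq_cf_den_add n.+1; have := cf_den_gt0 n; lia.
Qed.

Lemma den_err_sum n : (cf_den n.+1)%:R * cf_err n + (cf_den n)%:R * cf_err n.+1 = 1.
Proof.
elim: n => [|n IH]; first by rewrite /= /cf_err big_ord0 mul0r addr0 mulr1.
by rewrite -[RHS]IH cf_den_rec (cf_err_rec n) natrD natrM; ring.
Qed.

Lemma den_num_err n : (cf_den n)%:R * alpha - (cf_num n)%:~R = (-1) ^+ n.+1 * cf_err n.
Proof.
(* The recursion has depth two, so the induction carries two consecutive indices. *)
suff: (cf_den n)%:R * alpha - (cf_num n)%:~R = (-1) ^+ n.+1 * cf_err n /\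
      (cf_den n.+1)%:R * alpha - (cf_num n.+1)%:~R = (-1) ^+ n.+2 * cf_err n.+1 by case.
elim: n => [|n [IH1 IH2]].
  rewrite /cf_err big_ord_recr !big_ord0 /= /partial_quotient /frac_part; split.
    by rewrite expr1; ring.
  by rewrite sqrrN expr1n; ring.
split=> //.
transitivity (`|partial_quotient alpha n.+1|%:R * ((cf_den n.+1)%:R * alpha - (cf_num n.+1)%:~R)
   + ((cf_den n)%:R * alpha - (cf_num n)%:~R)).
  rewrite cf_den_rec natrD natrM /= -absz_partial_quotient /= intrD intrM; ring.
by rewrite IH1 IH2 (cf_err_rec n) !exprS; ring.
Qed.

Lemma den_num_det n : (cf_den n.+1)%:Z * cf_num n - (cf_den n)%:Z * cf_num n.+1 = (-1) ^+ n.
Proof.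
elim: n => [|n IH]; first by rewrite /= mul0r subr0 mulr1.
rewrite exprS -IH cf_den_rec [cf_num n.+2]/= -absz_partial_quotient PoszD PoszM; ring.
Qed.

(** Two consecutive convergents form a basis of the lattice of integer pairs, their determinant
    being a sign. *)
Lemma den_num_span n (d p : int) : exists u v : int,
  d = u * (cf_den n)%:Z + v * (cf_den n.+1)%:Z /\ p = u * cf_num n + v * cf_num n.+1.
Proof.
have := den_num_det n; set s := (-1) ^+ n => dt.
have ss : s * s = 1 by rewrite /s -exprMn mulrNN mul1r expr1n.
(* Cramer's rule; the determinant [s] is its own inverse. *)
exists (s * (p * (cf_den n.+1)%:Z - d * cf_num n.+1)), (s * (d * cf_num n - p * (cf_den n)%:Z)).
split.
  transitivity (s * s * d); first by rewrite ss mul1r.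
  by rewrite -{2}dt; ring.
transitivity (s * s * p); first by rewrite ss mul1r.
by rewrite -{2}dt; ring.
Qed.

(** Consecutive errors have opposite signs, hence the minus between the two terms. *)
Lemma err_span n (u v : int) (d : nat) (p : int) :
  (d : int) = u * (cf_den n)%:Z + v * (cf_den n.+1)%:Z -> p = u * cf_num n + v * cf_num n.+1 ->
  (-1) ^+ n.+1 * (d%:R * alpha - p%:~R) = u%:~R * cf_err n - v%:~R * cf_err n.+1.
Proof.
move=> dE pE.
have -> : d%:R * alpha - p%:~R = u%:~R * ((cf_den n)%:R * alpha - (cf_num n)%:~R)
     + v%:~R * ((cf_den n.+1)%:R * alpha - (cf_num n.+1)%:~R).
  by rewrite -[d%:R]/((Posz d)%:~R) dE pE !intrD !intrM /=; ring.
rewrite !den_num_err (exprS _ n.+1); set s := (-1) ^+ n.+1.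
have ss : s * s = 1 by rewrite /s -exprMn mulrNN mul1r expr1n.
transitivity (s * s * (u%:~R * cf_err n - v%:~R * cf_err n.+1)); first by ring.
by rewrite ss mul1r.
Qed.


(** In the coordinates of [den_num_span], the window forces [u] and [v] to be both at most 0 or both
    at least 1; then [d] is at most 0 or at least [cf_den n.+1 + cf_den n]. *)
Lemma one_sided_approx n (d : nat) (p : int) :
  (0 < d)%N -> (d < cf_den n.+1 + cf_den n)%N ->
  ~ (- cf_err n.+1 < (-1) ^+ n.+1 * (d%:R * alpha - p%:~R) < cf_err n).
Proof.
move=> d0 dQ; have [u [v [dE pE]]] := den_num_span n d p.
rewrite (err_span dE pE); have y0 := cf_err_gt0 n.+1; have x0 := cf_err_gt0 n.
have mono (w : int) (z : R) : 0 < z -> 0 < w%:~R * z -> 1 <= w.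
  by move=> z0; rewrite pmulr_lgt0 // ltr0z; lia.
have sgn (w : int) (z : R) : 0 < z -> w <= 0 -> w%:~R * z <= 0.
  by move=> z0 w0; rewrite pmulr_lle0 // lerz0.
have q0 := cf_den_gt0 n.
move=> /andP[h1 h2]; have [u0|u0] := lerP u 0.
  have : 1 <= 1 - v.
    by apply: (mono _ _ y0); have := sgn _ _ x0 u0; rewrite intrB; lra.
  by move=> v0; nia.
have : 1 <= v.
  have u1 : 1 - u <= 0 by lia.
  by apply: (mono _ _ y0); have := sgn _ _ x0 u1; rewrite intrB; lra.
by move=> v1; nia.
Qed.

(** Lagrange's law of best approximation. If it failed, [v] would be at least 1; then [u >= 0] makes
    [d] at least [cf_den n.+1], while [u < 0] makes both terms of the error negative, so that they
    add up to more than [cf_err n] in absolute value. *)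
Lemma best_approx n (d : nat) (p : int) :
  (0 < d)%N -> (d < cf_den n.+1)%N -> cf_err n <= `|d%:R * alpha - p%:~R|.
Proof.
move=> d0 dQ; have [u [v [dE pE]]] := den_num_span n d p.
rewrite -[X in _ <= X](normrMsign n.+1) (err_span dE pE).
have y0 := cf_err_gt0 n.+1; have x0 := cf_err_gt0 n.
have mono (w : int) (z : R) : 0 < z -> 0 < w%:~R * z -> 1 <= w.
  by move=> z0; rewrite pmulr_lgt0 // ltr0z; lia.
have sgn (w : int) (z : R) : 0 < z -> w <= 0 -> w%:~R * z <= 0.
  by move=> z0 w0; rewrite pmulr_lle0 // lerz0.
have q0 := cf_den_gt0 n.
rewrite leNgt; apply/negP; rewrite ltr_norml => /andP[h1 h2].
have [u0|u0] := lerP u 0.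
  have v1 : 1 <= v by nia.
  have vy : cf_err n.+1 <= v%:~R * cf_err n.+1.
    by rewrite -[X in X <= _]mul1r ler_pM2r // ler1z.
  have [uE|un] : u = 0 \/ u + 1 <= 0 by lia.
    by nia.
  by have := sgn _ _ x0 un; rewrite intrD; lra.
have : 1 <= v.
  have u1 : 1 - u <= 0 by lia.
  by apply: (mono _ _ y0); have := sgn _ _ x0 u1; rewrite intrB; lra.
by move=> v1; nia.
Qed.

End ContinuedFraction.

(** * Unions of arcs and measures of towers *)

(** One arc is halved; the halves are adjacent, which disjointness of half-open arcs permits. *)
Lemma is_union_of_arcs_split (R : realType) (n : nat) (B : set R) :
  is_union_of_arcs n.+1 B -> is_union_of_arcs n.+2 B.
Proof.
move=> [I [Iarc /trivIsetP Itriv ->]]; have [c [b [b0 b1 I0]]] := Iarc ord0.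
have {}I0 : I ord0 = torus_arc c (b / 2) `|` torus_arc (c + b / 2) (b / 2).
  by rewrite -arc_halve.
have b2 : 0 < b / 2 /\ b / 2 <= 1 by lra.
(* [J] replaces arc 0 by its right half, and [K] inserts the left half in front. *)
pose J (j : 'I_n.+1) := if j == ord0 then torus_arc (c + b / 2) (b / 2) else I j.
have JI j : J j `<=` I j.
  by rewrite /J; case: eqP => [->|_] x //; rewrite I0; right.
pose K (i : 'I_n.+2) := if unlift ord0 i is Some j then J j else torus_arc c (b / 2).
have K0 j : torus_arc c (b / 2) `&` J j = set0.
  rewrite /J; case: eqP => [_|/eqP j0]; first exact: arc_halve_disjoint.
  have jI0 : I j `&` I ord0 = set0 by exact: Itriv.
  by rewrite setIC; apply: subsetI_eq0 jI0 => // x x1; rewrite I0; left.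
exists K; split.
- move=> i; rewrite /K; case: unliftP => [j _|_]; last first.
    by case: b2 => b20 b21; exists c, (b / 2).
  rewrite /J; case: eqP => [_|_]; last exact: Iarc.
  by case: b2 => b20 b21; exists (c + b / 2), (b / 2).
- apply/trivIsetP => i i' _ _; rewrite /K.
  case: unliftP => [j ->|->]; case: unliftP => [j' ->|->] //.
  + move=> jj'; have : I j `&` I j' = set0.
      by apply: Itriv => //; apply: contra_neq jj' => ->.
    exact: subsetI_eq0.
  + by move=> _; rewrite setIC K0.
- apply/seteqP; split=> x [i _].
    have [->|i0] := eqVneq i ord0.
      rewrite I0 => -[x1|x2]; first by exists ord0; rewrite /K ?unlift_none.
      by exists (lift ord0 ord0); rewrite /K ?liftK /J.
    by move=> xi; exists (lift ord0 i) => //; rewrite /K liftK /J (negPf i0).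
  rewrite /K; case: unliftP => [j _ /JI xj|_ x0]; first by exists j.
  by exists ord0; rewrite ?I0 //; left.
Qed.

(** The towers below have [a + 1] arcs with [a] depending on the scale; this brings them all to the
    same number [k]. *)
Lemma is_union_of_arcs_le (R : realType) (n k : nat) (B : set R) :
  (n < k)%N -> is_union_of_arcs n.+1 B -> is_union_of_arcs k B.
Proof.
move=> nk Bn; rewrite -(subnK nk); elim: (k - n.+1)%N => // d.
by rewrite addSn addnS; exact: is_union_of_arcs_split.
Qed.

Lemma lebesgue_measure_bigcup_ord (R : realType) (n : nat) (F : nat -> set R)
    (b : nat -> R) :
  trivIset `I_n F -> (forall i, (i < n)%N -> measurable (F i)) ->
  (forall i, (i < n)%N -> lebesgue_measure (F i) = (b i)%:E) ->
  lebesgue_measure (\bigcup_(i in `I_n) F i) = (\sum_(i < n) b i)%:E.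
Proof.
move=> Ftriv Fmeas Fb; rewrite bigcup_mkord measure_semi_additive_ord_I //.
  by rewrite -sumEFin; apply: eq_bigr => i _; exact: Fb.
by apply: bigsetU_measurable => i _; exact: Fmeas.
Qed.

Lemma torus_measure_tower (R : realType) (h : nat) (F : nat -> set R) (b : R) :
  trivIset `I_h F -> (forall j, (j < h)%N -> measurable (F j)) ->
  (forall j, (j < h)%N -> F j `<=` @torus R) ->
  (forall j, (j < h)%N -> lebesgue_measure (F j) = b%:E) ->
  torus_measure (\bigcup_(j in `I_h) F j) = (h%:R * b)%:E.
Proof.
move=> Ftriv Fmeas Ft Fb; rewrite /torus_measure setIidl; last first.
  by move=> x [j /= jh]; exact: Ft.
rewrite (@lebesgue_measure_bigcup_ord _ _ _ (fun=> b)) //.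
by rewrite sumr_const card_ord mulr_natl.
Qed.

(* [s = 0] attaches all arcs of the tower to their left endpoints, [s = 1] to their
   right endpoints. *)
Definition level (R : realType) (alpha s : R) (h : nat) (w : nat -> R) (m : nat) :=
  torus_arc (m%:R * alpha - s * w (m %/ h)%N) (w (m %/ h)%N).

(** The arcs are based, up to the shift by [s], at the multiples of [h * alpha]. Iterate [j] of arc
    [i] is then level [i * h + j], so disjointness of the arcs and of their iterates reduces to that
    of one sequence of [n * h] levels. *)
Lemma level_tower (R : realType) (alpha s : R) (n h : nat) (w : nat -> R) : (0 < h)%N ->
  (forall i, (i < n)%N -> 0 < w i <= 1) ->
  (forall m m', (m < m')%N -> (m' < n * h)%N ->
     level alpha s h w m `&` level alpha s h w m' = set0) ->
  exists B : set R, [/\ is_union_of_arcs n B,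
    trivIset `I_h (fun j => iter j (rotation alpha) @` B) &
    torus_measure (\bigcup_(j in `I_h) (iter j (rotation alpha) @` B))
      = (h%:R * \sum_(i < n) w i)%:E].
Proof.
move=> h0 w01 lev; set L := level alpha s h w.
have Ltriv : trivIset `I_(n * h) L.
  apply/trivIsetP => i j /= ih jh; rewrite neq_ltn => /orP[ij|ji].
    exact: lev.
  by rewrite setIC lev.
have mulD i j : (i < n)%N -> (j < h)%N -> (i * h + j < n * h)%N by nia.
have divD i j : (j < h)%N -> ((i * h + j) %/ h)%N = i.
  by move=> jh; rewrite divnMDl // divn_small ?addn0.
have modD i j : (j < h)%N -> ((i * h + j) %% h)%N = j.
  by move=> jh; rewrite modnMDl modn_small.
pose B := \bigcup_(i : 'I_n) L (i * h)%N.
have TB j : (j < h)%N ->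
    iter j (rotation alpha) @` B = \bigcup_(i in `I_n) L (i * h + j)%N.
  move=> jh; have TL i : iter j (rotation alpha) @` L (i * h)%N = L (i * h + j)%N.
    rewrite /L /level iter_rotation_arc divD // mulnK //.
    by congr torus_arc; rewrite natrD; ring.
  rewrite /B image_bigcup; apply/seteqP; split=> x [i].
    by move=> _; rewrite TL => xi; exists (i : nat) => //=; exact: ltn_ord.
  by move=> /= ilt xi; exists (Ordinal ilt) => //; rewrite TL.
have Lmeas i j : (i < n)%N -> (j < h)%N -> measurable (L (i * h + j)%N).
  by move=> ilt jh; apply: measurable_arc; rewrite divD //; case/andP: (w01 _ ilt).
exists B; split.
- exists (fun i : 'I_n => L (i * h)%N); split=> //.
    move=> i; have /andP[wi0 wi1] := w01 i (ltn_ord i).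
    by rewrite /L /level mulnK //; exists ((i * h)%:R * alpha - s * w i), (w i).
  move=> i i' _ _ ii'; apply/val_inj/eqP; rewrite /= -(eqn_pmul2r h0); apply/eqP.
  by apply: Ltriv ii' => /=; rewrite -[(_ * h)%N]addn0; exact: mulD.
- move=> j j' /= jh jh'; rewrite !TB // => -[x [[i /= ilt xi] [i' /= ilt' xi']]].
  rewrite -(modD i j jh) -(modD i' j' jh'); congr modn.
  by apply: Ltriv; [exact: mulD|exact: mulD|exists x].
- apply: torus_measure_tower.
  + move=> j j' /= jh jh'; rewrite !TB // => -[x [[i /= ilt xi] [i' /= ilt' xi']]].
    rewrite -(modD i j jh) -(modD i' j' jh'); congr modn.
    by apply: Ltriv; [exact: mulD|exact: mulD|exists x].
  + move=> j jh; rewrite TB //; apply: fin_bigcup_measurable => // i ilt.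
    exact: Lmeas.
  + by move=> j jh; rewrite TB // => x [i _]; exact: arc_sub_torus.
  + move=> j jh; rewrite TB // (@lebesgue_measure_bigcup_ord _ _ _ w) //.
    * move=> i i' /= ilt ilt' ii'.
      rewrite -(divD i j jh) -(divD i' j jh); congr divn.
      by apply: Ltriv ii'; exact: mulD.
    * by move=> i ilt; exact: Lmeas.
    * move=> i ilt; rewrite /L /level divD // lebesgue_measure_arc //.
      by have := w01 _ ilt; lra.
Qed.

Lemma lim_esup_int_lt (R : realType) (a : nat -> int) (k : nat) :
  (limn_esup (fun i => ((a i)%:~R : R)%:E) <= (k%:R - 1)%:E)%E ->
  exists M, forall n, (M <= n)%N -> a n < k%:Z.
Proof.
move=> ak; have : (limn_esup (fun i => ((a i)%:~R : R)%:E) < (k%:R)%:E)%E.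
  by apply: le_lt_trans ak _; rewrite lte_fin; lra.
(* The limsup is an infimum of suprema over neighbourhoods [A] of infinity. It may not be attained,
   so the strict bound [k] is used to select one [A]. *)
move=> /ereal_inf_lt[_ [A [M _ MA] <-]] supA; exists M => n Mn.
rewrite -(ltr_int R) -lte_fin; apply: le_lt_trans supA.
by apply: ereal_sup_ubound; exists n => //; apply: MA.
Qed.

(** * Towers over one arc and over [k] arcs *)

Section Towers.
Context {R : realType} (alpha : R) (alpha_irr : irrational alpha).

Local Notation q := (cf_den alpha).
Local Notation d := (cf_err alpha).

Lemma leq_cf_den : {homo q : m n / (m <= n)%N}.
Proof.
apply: homo_leq => // [? ? ?|[//|n]]; first exact: leq_trans.
by have := leq_cf_den_add alpha_irr n; lia.
Qed.

Lemma cf_den_bracket h : (0 < h)%N -> exists N, (q N < h <= q N.+1)%N.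
Proof.
move=> h0; have exN : exists N, (h <= q N.+1)%N.
  by exists h; case: (cf_den_ge alpha_irr h).
case: (ex_minnP exN) => N hN minN; exists N; rewrite hN andbT.
(* At [N = 0] the lower bound holds because [q 0 = 0]. *)
case: N minN {hN} => [//|N] minN.
by rewrite ltnNge; apply/negP => /minN; rewrite ltnn.
Qed.

Lemma den_err_le1 N : (q N.+1)%:R * d N <= 1.
Proof.
by rewrite -[X in _ <= X](den_err_sum alpha_irr N) lerDl mulr_ge0 // ltW // cf_err_gt0.
Qed.

(** Of the two products in [den_err_sum], which add up to 1, this is the larger. *)
Lemma den_err_ge_half N : 1 <= 2 * ((q N.+1)%:R * d N).
Proof.
rewrite -[X in X <= _](den_err_sum alpha_irr N) [leRHS]mulr_natl mulr2n lerD2l.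
apply: ler_pM => //; first exact/ltW/cf_err_gt0.
  by rewrite ler_nat leq_cf_den.
exact/ltW/cf_err_lt.
Qed.

(** If the arc were longer than [d N], its iterate of order [q N < h], a shift by [d N] modulo 1,
    would meet it. *)
Lemma torus_measure_one_arc (N h : nat) (B : set R) :
  is_union_of_arcs 1 B -> (q N < h <= q N.+1)%N ->
  trivIset `I_h (fun j => iter j (rotation alpha) @` B) ->
  (torus_measure (\bigcup_(j in `I_h) (iter j (rotation alpha) @` B))
     <= ((q N.+1)%:R * d N)%:E)%E.
Proof.
move=> [I [Iarc _ BE]] /andP[qh hq]; have {BE} : B = I ord0.
  rewrite BE; apply/seteqP; split=> x; first by move=> [i _]; rewrite (ord1 i).
  by exists ord0.
have [c [b [b0 b1 ->]]] := Iarc ord0; rewrite -/(torus_arc c b) => -> Ttriv.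
rewrite (@torus_measure_tower _ _ _ b) //; last 3 first.
- by move=> j _; rewrite iter_rotation_arc; exact: measurable_arc.
- by move=> j _; rewrite iter_rotation_arc; exact: arc_sub_torus.
- move=> j _; rewrite iter_rotation_arc; apply: lebesgue_measure_arc.
  by rewrite (ltW b0).
rewrite lee_fin; apply: ler_pM => //; first exact: ltW.
  by rewrite ler_nat.
rewrite leNgt; apply/negP => db.
(* The return time [q 0 = 0] would give no collision, but [d 0 = 1] cannot be smaller than [b]. *)
have qN0 : (0 < q N)%N.
  case: N db {qh hq} => [|N _]; last exact: cf_den_gt0.
  by rewrite /cf_err big_ord0; lra.
suff : 0%N = q N by lia.
apply: Ttriv => //=; first exact: leq_ltn_trans qh.
rewrite image_id iter_rotation_arc.
apply: (@arc_meet _ _ _ _ (cf_num alpha N)).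
by rewrite (den_num_err alpha_irr) normrMsign gtr0_norm ?cf_err_gt0.
Qed.

Let w n (a i : nat) : R := if (i < a)%N then d n else d n.+1.

(** Arcs of equal width are separated by [best_approx]. A wide and a narrow arc meet only if their
    displacement lies in an asymmetric window; attaching them by left endpoints for odd [n] and by
    right endpoints for even [n] makes it the window excluded by [one_sided_approx]. *)
Lemma level_disjoint (n a h m m' : nat) :
  (0 < a)%N -> (a * h <= q n.+1)%N -> (a.+1 * h <= q n.+1 + q n)%N ->
  (m < m')%N -> (m' < a.+1 * h)%N ->
  level alpha (~~ odd n)%:R h (w n a) m
    `&` level alpha (~~ odd n)%:R h (w n a) m' = set0.
Proof.
move=> a0 ah aSh mm' m'h; set s := (~~ odd n)%:R.
have h0 : (0 < h)%N by lia.
have wE i : w n a (i %/ h)%N = if (i < a * h)%N then d n else d n.+1.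
  by rewrite /w ltn_divLR.
apply: arc_disjoint => p; rewrite !wE.
have -> (x y : R) : m'%:R * alpha - s * x - (m%:R * alpha - s * y) - p%:~R =
    (m' - m)%:R * alpha - p%:~R - s * (x - y).
  by rewrite natrB ?(ltnW mm') //; ring.
have Dlt := cf_err_lt alpha_irr n; have D1 := cf_err_gt0 alpha_irr n.+1.
have far (e : nat) : (0 < e < q n.+1)%N ->
    ~ (- d n < e%:R * alpha - p%:~R < d n).
  move=> /andP[e0 eq] hh; have := best_approx alpha_irr p e0 eq.
  by rewrite leNgt ltr_norml hh.
case: (ltnP m' (a * h)) => m'a.
  have -> : (m < a * h)%N by lia.
  by rewrite subrr mulr0 subr0; apply: far; lia.
(* Two narrow arcs have indices less than [h] apart, and [h <= a * h <= q n.+1]. *)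
case: (ltnP m (a * h)) => ma; last first.
  rewrite subrr mulr0 subr0 => hh; apply: (far (m' - m)%N); last by lra.
  by nia.
(* There remains a wide arc [m] followed by a narrow arc [m']. *)
have d0 : (0 < m' - m)%N by lia.
have dq : (m' - m < q n.+1 + q n)%N by lia.
have := one_sided_approx alpha_irr (p := p) d0 dq.
have -> : s = if odd n then 0 else 1 by rewrite /s; case: (odd n).
rewrite -signr_odd oddS; case: (odd n); rewrite ?expr0 ?expr1 => side hh.
  by apply: side; lra.
by apply: side; lra.
Qed.

(** With [a] the partial quotient, [h] is the largest integer such that
    [a.+1 * h <= q N.+2 + q N.+1], the room given by [level_disjoint] at [N.+1]. The widths add up
    to [d N] by [cf_err_rec]. *)
Lemma tower_of_arcs (k N : nat) : (`|partial_quotient alpha N.+1| < k)%N ->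
  let h := (q N.+1 + q N %/ `|partial_quotient alpha N.+1|.+1)%N in
  exists B : set R, [/\ is_union_of_arcs k B,
    trivIset `I_h (fun j => iter j (rotation alpha) @` B) &
    torus_measure (\bigcup_(j in `I_h) (iter j (rotation alpha) @` B))
      = (h%:R * d N)%:E].
Proof.
set a := `|_|%N => ak h.
have a0 : (0 < a)%N by have := partial_quotient_ge1 alpha_irr N; rewrite /a; lia.
have qE : q N.+2 = (a * q N.+1 + q N)%N := cf_den_rec alpha N.
have fq : (q N %/ a.+1 * a.+1 <= q N)%N by exact: leq_trunc_div.
have hq : (a.+1 * h <= q N.+2 + q N.+1)%N.
  by rewrite qE /h; move: (q N %/ a.+1)%N fq => f fq; nia.
have ahq : (a * h <= q N.+2)%N.
  by rewrite qE /h; move: (q N %/ a.+1)%N fq => f fq; nia.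
have h0 : (0 < h)%N by rewrite /h addn_gt0 cf_den_gt0.
have w01 i : (i < a.+1)%N -> 0 < w N.+1 a i <= 1.
  by rewrite /w; case: ifP => _ _; rewrite cf_err_gt0 ?cf_err_le1.
have [B [Barcs Btriv Bmeas]] :=
  level_tower h0 w01 (fun m m' => @level_disjoint N.+1 a h m m' a0 ahq hq).
exists B; split=> //; first exact: is_union_of_arcs_le Barcs.
rewrite Bmeas big_ord_recr (cf_err_rec alpha_irr N) -/a /=; congr (_ * (_ + _))%:E.
  transitivity (\sum_(i < a) d N.+1); last by rewrite sumr_const card_ord mulr_natl.
  by apply: eq_bigr => i _; rewrite /w ltn_ord.
by rewrite /w ltnn.
Qed.

Lemma tower_gain (k M : nat) :
  (forall n, (M <= n)%N -> partial_quotient alpha n < k%:Z) ->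
  exists2 eps : R, 0 < eps & exists M', forall N, (M' <= N)%N ->
  exists (h : nat) (B : set R), [/\ (q N.+1 <= h)%N, is_union_of_arcs k B,
    trivIset `I_h (fun j => iter j (rotation alpha) @` B) &
    (((q N.+1)%:R * d N + eps)%:E <=
       torus_measure (\bigcup_(j in `I_h) (iter j (rotation alpha) @` B)))%E].
Proof.
move=> ak; have {}ak n : (M <= n)%N -> (`|partial_quotient alpha n.+1| < k)%N.
  move=> Mn; have := ak n.+1; have := partial_quotient_ge1 alpha_irr n.
  by move: (partial_quotient _ _) => a a1 /(_ (leqW Mn)); lia.
have k0 : (0 < k)%N by apply: leq_trans (ak M (leqnn _)).
have k0R : 0 < k%:R :> R by rewrite ltr0n.
exists (4 * k%:R * k%:R)^-1; first by rewrite invr_gt0 !mulr_gt0.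
(* Beyond [M] the partial quotients are below [k]; the extra [k] ensures [k <= q N.+1], so that the
   quotient [f] below is positive. *)
exists (M + k).+1 => -[//|N]; rewrite ltnS => MN.
have := ak N.+1; have := ak N; set a := `|partial_quotient alpha N.+2|%N.
set a' := `|partial_quotient alpha N.+1|%N => a'k {}ak.
have {}a'k : (a' < k)%N by apply: a'k; lia.
have {}ak : (a < k)%N by apply: ak; lia.
have [B [Barcs Btriv Bmeas]] := tower_of_arcs ak.
exists (q N.+2 + q N.+1 %/ a.+1)%N, B; split=> //; first exact: leq_addr.
rewrite Bmeas lee_fin (natrD _ (q N.+2)) [leRHS]mulrDl lerD2l -/a.
set f := (q N.+1 %/ a.+1)%N.
(* The gain is [f * d N.+1]. Rounding down costs at most a factor 2, so [q N.+1 <= 2 * k * f], and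
   [q N.+2 <= k * q N.+1]. With [q N.+2 * d N.+1 >= 1/2] this yields the constant [1 / (4 k^2)]. *)
have qk : (q N.+2 <= 2 * k * k * f)%N.
  have kq : (k <= q N.+1)%N by have [] := cf_den_ge alpha_irr N; lia.
  have qE : q N.+2 = (a' * q N.+1 + q N)%N := cf_den_rec alpha N.
  have qle := leq_cf_den (leqnSn N).
  have fk : (q N.+1 %/ k <= f)%N by exact: leq_div2l.
  have kdiv : (q N.+1 < k * (q N.+1 %/ k).+1)%N.
    by rewrite mulnC ltn_ceil.
  have fk1 : (0 < q N.+1 %/ k)%N by rewrite divn_gt0.
  have step1 : (q N.+1 <= 2 * k * f)%N by nia.
  have step2 : (q N.+2 <= k * q N.+1)%N by nia.
  by apply: leq_trans step2 _; nia.
have dpos := cf_err_gt0 alpha_irr N.+1.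
rewrite -[leLHS]mul1r ler_pdivrMr ?mulr_gt0 //.
have := den_err_ge_half N.+1; have : (q N.+2)%:R <= (2 * k * k * f)%:R :> R by rewrite ler_nat.
rewrite !natrM => qkR qd; apply: le_trans qd _.
rewrite (_ : f%:R * _ * _ = 2 * ((2 * k%:R * k%:R * f%:R) * d N.+1)); last by ring.
by rewrite ler_pM2l // ler_pM2r.
Qed.

End Towers.

(** * Comparison of the covering numbers *)

Theorem theorem1p7 (R : realType) (k : nat) (alpha : R)
  (hk : (0 < k)%N)
  (halpha : irrational alpha)
  (ha : (limn_esup (fun i : nat => ((partial_quotient alpha i)%:~R : R)%:E)
         <= (k%:R - 1)%:E)%E) :
  (covering_number 1 (rotation alpha) < covering_number k (rotation alpha))%E.
Proof.
have [M0 ak] := lim_esup_int_lt ha.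
have [eps eps0 [M gain]] := tower_gain halpha ak.
(* A value [z] admissible for one arc is below [q_N d_(N-1)] for arbitrarily large denominators. *)
have one z : (forall h0 : nat, (0 < h0)%N -> exists (h : nat) (B : set R),
      [/\ (h0 <= h)%N, is_union_of_arcs 1 B,
          trivIset `I_h (fun j => iter j (rotation alpha) @` B) &
          (z%:E <= torus_measure
             (\bigcup_(j in `I_h) (iter j (rotation alpha) @` B)))%E]) ->
    forall h0, exists N, [/\ (M <= N)%N, (h0 <= cf_den alpha N.+1)%N &
      z <= (cf_den alpha N.+1)%:R * cf_err alpha N].
  (* Taking [h] beyond [cf_den alpha M] forces the bracketing index to be at least [M]. *)
  move=> Sz h0; have [|h [B [hh Barc Btriv zB]]] := Sz (maxn h0 (cf_den alpha M)).+1 => //.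
  have [|N /[dup] hN /andP[qh hq]] := cf_den_bracket halpha (h := h); first by lia.
  exists N; split; last 1 first.
  - by rewrite -lee_fin; apply: le_trans zB (torus_measure_one_arc halpha Barc hN Btriv).
  - rewrite leqNgt; apply/negP => NM.
    by have := leq_cf_den halpha NM; lia.
  - by lia.
(* At each such scale the tower of [k] arcs covers [eps] more. *)
have gain_ge (z : R) : (forall h0, exists N, [/\ (M <= N)%N, (h0 <= cf_den alpha N.+1)%N &
      z <= (cf_den alpha N.+1)%:R * cf_err alpha N]) ->
    ((z + eps)%:E <= covering_number k (rotation alpha))%E.
  move=> Hz; apply: ereal_sup_ubound; exists (z + eps) => // h0 _.
  have [N [MN hN zN]] := Hz h0; have [h [B [hq Barcs Btriv Bmeas]]] := gain N MN.
  exists h, B; split=> //; first exact: leq_trans hq.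
  by apply: le_trans Bmeas; rewrite lee_fin lerD2r.
(* This excludes the value [-oo] for the larger covering number. *)
have Fk_half : ((2^-1 + eps)%:E <= covering_number k (rotation alpha))%E.
  apply: gain_ge => h0; exists (maxn M h0); split; first exact: leq_maxl.
    by have [] := cf_den_ge halpha (maxn M h0); lia.
  by have := den_err_ge_half halpha (maxn M h0); lra.
case: (covering_number k _) Fk_half gain_ge => [r| |] // _ gain_ge.
  apply: (@le_lt_trans _ _ (r - eps)%:E); last by rewrite lte_fin; lra.
  apply: ge_ereal_sup => _ [z Sz <-]; have := gain_ge z (one z Sz).
  by rewrite !lee_fin; lra.
(* If the larger covering number were [+oo], the bound 1 on the smaller one would suffice. *)
apply: (@le_lt_trans _ _ 1%:E); last exact: ltry.
apply: ge_ereal_sup => _ [z Sz <-]; have [N [_ _ zN]] := one z Sz 0%N.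
by rewrite lee_fin; apply: le_trans zN (den_err_le1 halpha N).
Qed.
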